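(* Let $g\in\Gamma_0(\mathbb{R}^N)$ be polyhedral, let $A$ be a real $M\times N$ matrix, let $y\in\,]0,+\infty[^M$, and let $f(x)=g(x)+KL(y;Ax)$ for $x\in\mathbb{R}^N$. If $\operatorname{argmin} f\neq\emptyset$, then $f$ is $2$-conditioned on bounded sets, i.e. $f$ is $2$-conditioned on every bounded subset of $\mathbb{R}^N$.
   Context: $\Gamma_0(\mathbb{R}^N)$ is the set of proper, convex, lower semicontinuous functions $\mathbb{R}^N\to]-\infty,+\infty]$; polyhedral means that the epigraph is a polyhedron. The Kullback–Leibler divergence is $KL(\bar z;z)=\sum_{i=1}^M kl(\bar z_i;z_i)$ for $\bar z\in\,]0,+\infty[^M$, $z\in\mathbb{R}^M$, where $kl(\bar t;t)=\bar t\log(\bar t/t)-\bar t+t$ if $t>0$ and $kl(\bar t;t)=+\infty$ otherwise. $f$ (with $\operatorname{argmin} f\ne\emptyset$) is $2$-conditioned on $\Omega$ if there is $\gamma>0$ such that $\frac{\gamma}{2}\operatorname{dist}(x,\operatorname{argmin} f)^2\le f(x)-\inf f$ for all $x\in\Omega\cap\operatorname{dom} f$. *)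

(* Defs.v *)
From mathcomp Require Import all_boot all_order all_algebra.
From mathcomp Require Import all_classical all_reals all_analysis.

Set Implicit Arguments.
Unset Strict Implicit.
Unset Printing Implicit Defensive.

Import Order.TTheory GRing.Theory Num.Theory.
Import numFieldNormedType.Exports.

Local Open Scope classical_set_scope.
Local Open Scope ring_scope.

(* The library norm on matrices is the sup norm (it gives the usual topology
   and the usual bounded sets); distances below use the Euclidean norm. *)
Definition enorm (R : realType) (n : nat) (x : 'cV[R]_n) : R :=
  Num.sqrt (\sum_(i < n) x i 0 ^+ 2).

(* Meaningful for [S] nonempty only, as [inf set0 = 0]. *)
Definition edistance (R : realType) (n : nat) (x : 'cV[R]_n)
    (S : set 'cV[R]_n) : R :=
  inf [set enorm (x - z) | z in S].

Definition polyhedron (R : realType) (n : nat) (P : set 'cV[R]_n) : Prop :=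
  exists (k : nat) (C : 'M[R]_(k, n)) (b : 'cV[R]_k),
    P = [set x | forall i, (C *m x) i 0 <= b i 0].

Section extended_real_valued_functions.
Variables (R : realType) (n : nat).
Implicit Types f : 'cV[R]_n -> \bar R.

Definition effective_domain f : set 'cV[R]_n := [set x | (f x < +oo)%E].

Definition proper_fun f : Prop :=
  effective_domain f !=set0 /\ forall x, (-oo < f x)%E.

Definition econvex f : Prop :=
  forall (x y : 'cV[R]_n) (t : R), 0 <= t <= 1 ->
    (f (t *: x + (1 - t) *: y)%R <= t%:E * f x + (1 - t)%:E * f y)%E.

Definition Gamma0 : set ('cV[R]_n -> \bar R) :=
  [set f | [/\ proper_fun f, econvex f & lower_semicontinuous f]].

(* R^n x R is encoded as R^(n+1), the last coordinate being the height. *)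
Definition epigraph f : set 'cV[R]_(n + 1) :=
  [set z | (f (usubmx z) <= (dsubmx z 0 0)%:E)%E].

Definition polyhedral f : Prop := polyhedron (epigraph f).

Definition argmin f : set 'cV[R]_n := [set x | forall z, (f x <= f z)%E].

Definition two_conditioned (Omega : set 'cV[R]_n) f : Prop :=
  exists2 gamma : R, 0 < gamma &
    forall x, (Omega `&` effective_domain f) x ->
      ((gamma / 2 * edistance x (argmin f) ^+ 2)%:E
        <= f x - ereal_inf (range f))%E.

Definition two_conditioned_on_bounded_sets f : Prop :=
  forall Omega : set 'cV[R]_n, bounded_set Omega -> two_conditioned Omega f.

End extended_real_valued_functions.

Definition kl (R : realType) (tbar t : R) : \bar R :=
  if 0 < t then (tbar * ln (tbar / t) - tbar + t)%:E else +oo%E.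

Definition KL (R : realType) (m : nat) (zbar z : 'cV[R]_m) : \bar R :=
  (\sum_(i < m) kl (zbar i ord0) (z i ord0))%E.

(* Main.v *)
Require Import Defs.
From mathcomp Require Import all_boot all_order all_algebra.
From mathcomp Require Import all_classical all_reals all_analysis.
From mathcomp Require Import ring lra.

(** Let [xs] minimize [f], let [c = A xs] and let [w] be the gradient of [KL y]
at [c], that is [w i = 1 - y i / c i]. For [x] in the domain of [f],
[f x - f xs = h x + D (A x)], where [h x = g x - g xs + <w, A x - c>] and [D] is
the Bregman divergence of [KL y] at [c] ([KLr_bregman]). Both terms are
nonnegative: [h] by first-order optimality of [xs] ([KLr_first_order]), and [D]
by convexity, with moreover [|A x - c|^2 <= K * D (A x)] when [A x] is bounded
([bregman_quadratic_growth]).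

Every [x] with [h x <= 0] and [A x = c] is a minimizer. As [g] is polyhedral,
these conditions form a system of linear inequalities in the epigraph space, and
Hoffman's error bound ([hoffman], [polyhedral_error_bound]) controls the
distance from [x] to its solutions by a multiple of [max (h x) |A x - c|]. The
square of [|A x - c|] is at most [K * (f x - f xs)]; so is that of [h x], with
constant 1, as long as [f x - f xs <= 1]. Where [f x - f xs >= 1], the inequality
only says that the distance is bounded, which holds on bounded sets.

Hoffman's bound itself is obtained by Fourier-Motzkin elimination of one
variable at a time ([clamp], [hoffman_family]). *)

Set Implicit Arguments.
Unset Strict Implicit.

Import Order.TTheory GRing.Theory Num.Theory.
Import numFieldNormedType.Exports.

Local Open Scope classical_set_scope.
Local Open Scope ring_scope.

(** * Hoffman's error bound *)

(** The one-variable case of the error bound, when some upper bound on the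
variable fails at [z]: moving [z] down to the smallest upper bound repairs all
upper bounds, and by the elimination hypothesis it breaks no lower bound. *)
Lemma clamp_above (R : realFieldType) (I : finType) (c r : I -> R) (z e : R)
    (i0 : I) :
  (forall i, c i = 0 -> 0 <= r i) ->
  (forall i j, 0 < c i -> c j < 0 -> c j * r i <= c i * r j) ->
  (forall i, c i * z <= r i + e) ->
  0 < c i0 -> r i0 < c i0 * z ->
  exists2 t, forall i, c i * t <= r i & `|z - t| <= (\sum_i `|c i|^-1) * e.
Proof.
move=> zero_ok elim_ok z_ok c0 viol.
case: (@arg_minP _ R I i0 (fun i => 0 < c i) (fun i => r i / c i) c0) => i ci imin.
exists (r i / c i).
  move=> j; have [cj|cj|cj] := ltrgt0P (c j).
  - by rewrite mulrC -ler_pdivlMr //; exact: imin.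
  - by rewrite mulrA ler_pdivrMr // [leRHS]mulrC; exact: elim_ok.
  - by rewrite cj mul0r; exact: zero_ok.
have zt : r i / c i < z.
  by apply: le_lt_trans (imin _ c0) _; rewrite ltr_pdivrMr // mulrC.
have ztE : z - r i / c i = (c i * z - r i) / c i by field; rewrite gt_eqF.
have gap_le : c i * z - r i <= e by rewrite lerBlDl z_ok.
have gap_ge : 0 <= c i * z - r i.
  by rewrite subr_ge0 mulrC -ler_pdivrMr // ltW.
rewrite gtr0_norm ?subr_gt0 // ztE mulrC.
apply: ler_pM => //; first by rewrite invr_ge0 ltW.
rewrite (bigD1 i) //= gtr0_norm // lerDl.
by apply: sumr_ge0 => k _; rewrite invr_ge0.
Qed.

(** One-variable error bound. The constant depends on the slopes [c] but not on
the right-hand sides [r]; this uniformity is what lets the induction on the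
number of variables use it with [r] depending on the other coordinates. *)
Lemma clamp (R : realFieldType) (I : finType) (c r : I -> R) (z e : R) :
  0 <= e ->
  (forall i, c i = 0 -> 0 <= r i) ->
  (forall i j, 0 < c i -> c j < 0 -> c j * r i <= c i * r j) ->
  (forall i, c i * z <= r i + e) ->
  exists2 t, forall i, c i * t <= r i & `|z - t| <= (\sum_i `|c i|^-1) * e.
Proof.
move=> e0 zero_ok elim_ok z_ok.
have [/existsP[i /andP[ci viol]]|/existsPn noabove] :=
    boolP [exists i, (0 < c i) && (r i < c i * z)].
  exact: (@clamp_above _ _ _ _ _ _ i).
have [/existsP[i /andP[ci viol]]|/existsPn nobelow] :=
    boolP [exists i, (c i < 0) && (r i < c i * z)].
  have [|j k|j|||t t_ok zt] := @clamp_above _ _ (fun i => - c i) r (- z) e i.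
  - by move=> j /eqP; rewrite oppr_eq0 => /eqP; exact: zero_ok.
  - rewrite oppr_gt0 oppr_lt0 => cj ck.
    by rewrite !mulNr lerN2; exact: elim_ok.
  - by rewrite mulrNN.
  - by rewrite oppr_gt0.
  - by rewrite mulrNN.
  exists (- t) => [j|]; first by rewrite mulrN -mulNr.
  have -> : z - - t = - (- z - t) by ring.
  by rewrite normrN; move: zt; under eq_bigr do rewrite normrN.
exists z => [i|]; last first.
  rewrite subrr normr0; apply: mulr_ge0 => //; apply: sumr_ge0 => i _.
  by rewrite invr_ge0.
have [ci|ci|ci] := ltrgt0P (c i).
- by have := noabove i; rewrite ci /= -leNgt.
- by have := nobelow i; rewrite ci /= -leNgt.
- by rewrite ci mul0r; exact: zero_ok.
Qed.

(** Hoffman's bound by Fourier-Motzkin elimination of the first variable. The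
eliminated system consists of nonnegative combinations of the given
constraints, so a point violating the given system by at most [e] violates it
by at most a multiple of [e]. Induction repairs the other coordinates, and the
first one is then clamped between the bounds that they leave to it. Arbitrary
finite index types are needed because elimination indexes the new constraints
by pairs of old ones. *)
Lemma hoffman_family (R : realFieldType) (n : nat) (I : finType)
    (a : I -> 'I_n -> R) (b : I -> R) :
  (exists p : 'I_n -> R, forall i, \sum_j a i j * p j <= b i) ->
  exists2 L : R, 0 <= L & forall (e : R) (z : 'I_n -> R), 0 <= e ->
    (forall i, \sum_j a i j * z j <= b i + e) ->
    exists2 q : 'I_n -> R, forall i, \sum_j a i j * q j <= b i
      & forall j, `|z j - q j| <= L * e.
Proof.
elim: n I a b => [|n IHn] I a b [p p_ok].
  exists 0 => // e z _ _; exists z => [i|[]//].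
  by have := p_ok i; rewrite !big_ord0.
pose c i := a i ord0; pose a' i j := a i (lift ord0 j).
have splitE i (z : 'I_n.+1 -> R) : \sum_j a i j * z j =
    c i * z ord0 + \sum_j a' i j * z (lift ord0 j) by rewrite big_ord_recl.
(* The new constraint of the pair (i, j) is al * (i) + be * (j): the classical
   combination for an upper bound i and a lower bound j, the constraint i itself
   if it does not involve the first variable, and 0 <= 0 otherwise. *)
pose al (ij : I * I) := if (0 < c ij.1) && (c ij.2 < 0) then - c ij.2
                        else (c ij.1 == 0)%:R.
pose be (ij : I * I) := if (0 < c ij.1) && (c ij.2 < 0) then c ij.1 else 0.
have al0 ij : 0 <= al ij.
  by rewrite /al; case: ifP => [/andP[_ /ltW]|]; rewrite ?oppr_ge0.
have be0 ij : 0 <= be ij by rewrite /be; case: ifP => // /andP[/ltW].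
have elim_c ij : al ij * c ij.1 + be ij * c ij.2 = 0.
  rewrite /al /be; case: ifP => _; first by ring.
  by case: eqP => [->|_]; rewrite ?mulr0 !mul0r addr0.
pose a2 (ij : I * I) j := al ij * a' ij.1 j + be ij * a' ij.2 j.
pose b2 (ij : I * I) := al ij * b ij.1 + be ij * b ij.2.
have a2E ij (z : 'I_n -> R) : \sum_j a2 ij j * z j =
    al ij * (\sum_j a' ij.1 j * z j) + be ij * (\sum_j a' ij.2 j * z j).
  rewrite !mulr_sumr -big_split /=; apply: eq_bigr => j _.
  by rewrite /a2; ring.
have a2_le ij (z : 'I_n.+1 -> R) e : (forall i, \sum_j a i j * z j <= b i + e) ->
    \sum_j a2 ij j * z (lift ord0 j) <= b2 ij + (al ij + be ij) * e.
  move=> z_ok.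
  have -> : \sum_j a2 ij j * z (lift ord0 j) =
      al ij * (\sum_j a ij.1 j * z j) + be ij * (\sum_j a ij.2 j * z j).
    rewrite a2E !splitE.
    transitivity ((al ij * c ij.1 + be ij * c ij.2) * z ord0 +
      (al ij * (\sum_j a' ij.1 j * z (lift ord0 j)) +
       be ij * (\sum_j a' ij.2 j * z (lift ord0 j)))); last by ring.
    by rewrite elim_c mul0r add0r.
  have := ler_wpM2l (al0 ij) (z_ok ij.1).
  have := ler_wpM2l (be0 ij) (z_ok ij.2).
  by rewrite /b2; lra.
have [|L' L'0 HL'] := IHn _ a2 b2.
  exists (fun j => p (lift ord0 j)) => ij.
  have := @a2_le ij p 0; rewrite mulr0 addr0; apply=> i.
  by rewrite addr0.
pose K := \sum_ij (al ij + be ij).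
have K0 : 0 <= K by apply: sumr_ge0 => ij _; rewrite addr_ge0.
(* With r as below, the constraints on the first variable alone, given the
   repaired other coordinates, are violated at z by at most G * e. *)
pose G := 1 + \sum_i \sum_j `|a' i j| * (L' * K).
have G0 : 0 <= G.
  rewrite addr_ge0 // sumr_ge0 // => i _; rewrite sumr_ge0 // => j _.
  by rewrite !mulr_ge0.
pose L1 := \sum_i `|c i|^-1.
have L10 : 0 <= L1 by apply: sumr_ge0 => i _; rewrite invr_ge0.
exists (L' * K + L1 * G); first by rewrite addr_ge0 ?mulr_ge0.
move=> e z e0 z_ok.
have [|ij|q' q'_ok zq'] := HL' (K * e) (fun j => z (lift ord0 j)).
- exact: mulr_ge0.
- apply: le_trans (a2_le ij z e z_ok) _; rewrite lerD2l ler_wpM2r //.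
  rewrite /K (bigD1 ij) //= lerDl; apply: sumr_ge0 => k _.
  by rewrite addr_ge0.
pose r i := b i - \sum_j a' i j * q' j.
have [||i j ci cj|i|t t_ok zt] := @clamp R I c r (z ord0) (G * e).
- exact: mulr_ge0.
- move=> i ci; have := q'_ok (i, i); rewrite a2E /b2 /al /be /= ci ltxx eqxx /=.
  by rewrite /r; lra.
- have := q'_ok (i, j); rewrite a2E /b2 /al /be /= ci cj /= /r; lra.
- have move_q' : - (\sum_j a' i j * (z (lift ord0 j) - q' j)) <=
      (\sum_i \sum_j `|a' i j| * (L' * K)) * e.
    apply: le_trans (ler_norm _) _; rewrite normrN.
    apply: le_trans (ler_norm_sum _ _ _) _.
    apply: (@le_trans _ _ ((\sum_j `|a' i j| * (L' * K)) * e)).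
      rewrite mulr_suml ler_sum // => j _.
      by rewrite normrM -!mulrA ler_wpM2l.
    rewrite ler_wpM2r // [leRHS](bigD1 i) //= lerDl.
    apply: sumr_ge0 => k _; apply: sumr_ge0 => j _.
    by rewrite !mulr_ge0.
  move: move_q'; under eq_bigr do rewrite mulrBr.
  have := z_ok i; rewrite splitE sumrB /r /G; lra.
exists (fun j => oapp q' t (unlift ord0 j)) => [i|j].
  rewrite splitE unlift_none /=; under eq_bigr do rewrite liftK /=.
  by have := t_ok i; rewrite /r; lra.
rewrite mulrDl; case: unliftP => [k ->|->] /=.
  apply: le_trans (zq' k) _; rewrite mulrA lerDl.
  by rewrite !mulr_ge0.
by apply: le_trans zt _; rewrite mulrA lerDr !mulr_ge0.
Qed.

Lemma hoffman (R : realFieldType) (k n : nat) (C : 'M[R]_(k, n))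
    (b : 'cV[R]_k) :
  (exists p : 'cV[R]_n, forall i, (C *m p) i 0 <= b i 0) ->
  exists2 L : R, 0 <= L & forall (e : R) (z : 'cV[R]_n), 0 <= e ->
    (forall i, (C *m z) i 0 <= b i 0 + e) ->
    exists2 q : 'cV[R]_n, forall i, (C *m q) i 0 <= b i 0
      & forall j, `|z j 0 - q j 0| <= L * e.
Proof.
move=> [p p_ok].
have [|L L0 HL] := @hoffman_family R n _ (fun i j => C i j) (fun i => b i 0).
  by exists (fun j => p j 0) => i; have := p_ok i; rewrite mxE.
exists L => // e z e0 z_ok.
have [|i|q q_ok zq] := HL e (fun j => z j 0) => //.
  by have := z_ok i; rewrite mxE.
exists (\col_j q j) => [i|j]; last by rewrite mxE.
by rewrite mxE; under eq_bigr do rewrite mxE.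
Qed.

(** * Error bound for polyhedral functions *)

(** Hoffman's bound for the lifted system in (q, t) whose inequalities are
[g q <= t], [t + v q <= m], [A q <= c] and [- A q <= - c]. Lifting to the
epigraph makes the sublevel set of a polyhedral function a linear system,
without a max-of-affine formula for [g]. *)
Lemma polyhedral_error_bound (R : realType) (N M : nat) (g : 'cV[R]_N -> \bar R)
    (A : 'M[R]_(M, N)) (c : 'cV[R]_M) (v : 'rV[R]_N) (m : R)
    (p : 'cV[R]_N) (s : R) :
  polyhedral g ->
  (g p <= s%:E)%E -> s + (v *m p) 0 0 <= m -> A *m p = c ->
  exists2 L : R, 0 <= L & forall (e r : R) (x : 'cV[R]_N), 0 <= e ->
    (g x <= r%:E)%E -> r + (v *m x) 0 0 <= m + e ->
    (forall i, `|(A *m x) i 0 - c i 0| <= e) ->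
    exists q : 'cV[R]_N, exists t : R,
      [/\ (g q <= t%:E)%E, t + (v *m q) 0 0 <= m, A *m q = c
        & forall j, `|x j 0 - q j 0| <= L * e].
Proof.
move=> [k [C [b epiE]]] gp sp Ap.
have epiP x r : (g x <= r%:E)%E <->
    forall i, (C *m col_mx x (r%:M : 'cV_1)) i 0 <= b i 0.
  have : epigraph g (col_mx x (r%:M : 'cV_1)) = (g x <= r%:E)%E :> Prop.
    by rewrite /epigraph /= col_mxKu col_mxKd mxE eqxx mulr1n.
  by rewrite epiE /= => ->.
pose D := col_mx C (col_mx (row_mx v (1%:M : 'M[R]_(1, 1)))
  (col_mx (row_mx A 0) (row_mx (- A) (0 : 'M[R]_(M, 1))))).
pose d := col_mx b (col_mx (m%:M : 'cV_1) (col_mx c (- c))).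
have sysP x r e : (forall i, (D *m col_mx x (r%:M : 'cV_1)) i 0 <= d i 0 + e) <->
    [/\ forall i, (C *m col_mx x (r%:M : 'cV_1)) i 0 <= b i 0 + e,
        r + (v *m x) 0 0 <= m + e & forall i, `|(A *m x) i 0 - c i 0| <= e].
  have oppE (Z : 'cV[R]_M) i : (- Z) i 0 = - Z i 0 by rewrite mxE.
  rewrite /D /d !mul_col_mx !mul_row_col !mul0mx !addr0 mul1mx mulNmx.
  split => [H|[HC Hm HA] i].
    split=> [i||i].
    - by have := H (lshift _ i); rewrite !col_mxEu.
    - have := H (rshift _ (lshift _ 0)); rewrite !col_mxEd !col_mxEu.
      by rewrite !mxE eqxx !mulr1n addrC.
    - have := H (rshift _ (rshift _ (lshift _ i))).
      have := H (rshift _ (rshift _ (rshift _ i))).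
      rewrite !col_mxEd !col_mxEu ?oppE => Hl Hu.
      by rewrite ler_norml; lra.
  case: (split_ordP i) => {}i ->; first by rewrite !col_mxEu.
  rewrite !col_mxEd; case: (split_ordP i) => {}i ->.
    by rewrite !col_mxEu !mxE (ord1 i) eqxx !mulr1n; move: Hm; rewrite mxE addrC.
  rewrite !col_mxEd; case: (split_ordP i) => {}i ->;
    rewrite ?col_mxEd ?col_mxEu; have := HA i;
    rewrite ?oppE ler_norml; lra.
have decol (z : 'cV[R]_(N + 1)) :
    z = col_mx (usubmx z) ((dsubmx z 0 0)%:M : 'cV_1).
  by rewrite -mx11_scalar vsubmxK.
have [|L L0 HL] := @hoffman R _ _ D d.
  exists (col_mx p s%:M) => i; rewrite -[leRHS]addr0; move: i; apply/sysP.
  split=> [i||i]; last by rewrite Ap subrr normr0.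
  - by rewrite addr0; move: i; exact/epiP.
  - by rewrite addr0.
exists L => // e r x e0 gx rx Ax.
have [|z z_ok xz] := HL e (col_mx x r%:M) e0.
  apply/sysP; split=> // i; rewrite -[leLHS]addr0 lerD //.
  by move: i; exact/epiP.
rewrite (decol z) in z_ok xz.
have /sysP[zC zv zA] : forall i,
    (D *m col_mx (usubmx z) ((dsubmx z 0 0)%:M : 'cV_1)) i 0 <= d i 0 + 0.
  by move=> i; rewrite addr0.
exists (usubmx z), (dsubmx z 0 0); split.
- by apply/epiP => i; have := zC i; rewrite addr0.
- by rewrite addr0 in zv.
- apply/matrixP => i j; rewrite (ord1 j); apply/eqP.
  by rewrite -subr_eq0 -normr_le0.
- by move=> j; have := xz (lshift _ j); rewrite !col_mxEu.
Qed.

(** * Distances and bounded sets *)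

Lemma edistance_ge0 (R : realType) (n : nat) (x : 'cV[R]_n) (S : set 'cV[R]_n) :
  S !=set0 -> 0 <= edistance x S.
Proof.
move=> [z Sz]; apply: lb_le_inf; first by exists (enorm (x - z)), z.
by move=> _ [u _ <-]; exact: sqrtr_ge0.
Qed.

Lemma edistance_sqr_le (R : realType) (n : nat) (x z : 'cV[R]_n)
    (S : set 'cV[R]_n) (d : R) :
  S z -> (forall j, `|x j 0 - z j 0| <= d) ->
  edistance x S ^+ 2 <= n%:R * d ^+ 2.
Proof.
move=> Sz xz.
have le_enorm : edistance x S <= enorm (x - z).
  apply: ge_inf; last by exists z.
  by exists 0 => _ [u _ <-]; exact: sqrtr_ge0.
apply: (@le_trans _ _ (enorm (x - z) ^+ 2)).
  by rewrite ler_pXn2r // ?nnegrE ?sqrtr_ge0 // edistance_ge0 //; exists z.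
rewrite sqr_sqrtr; last by apply: sumr_ge0 => i _; exact: sqr_ge0.
have -> : n%:R * d ^+ 2 = \sum_(i < n) d ^+ 2.
  by rewrite sumr_const card_ord mulr_natl.
rewrite ler_sum // => i _.
rewrite !mxE -real_normK ?num_real // ler_pXn2r ?nnegrE //.
exact: le_trans (xz i).
Qed.

Lemma bounded_coord (R : realType) (n : nat) (Omega : set 'cV[R]_n) :
  bounded_set Omega ->
  exists2 B : R, 0 <= B & forall x, Omega x -> forall j, `|x j 0| <= B.
Proof.
move=> /ex_strict_bound_gt0[B B0 HB]; exists B; first exact: ltW.
move=> x Ox j; apply: le_trans (ltW (HB x Ox)).
rewrite [leRHS]mx_normrE; exact: (le_bigmax _ _ (j, 0)).
Qed.

Lemma mulmx_coord_le (R : realType) (m n : nat) (A : 'M[R]_(m, n)) (B : R) :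
  exists B' : R, forall x : 'cV[R]_n, (forall j, `|x j 0| <= B) ->
    forall i, (A *m x) i 0 <= B'.
Proof.
exists (\sum_i \sum_j `|A i j| * `|B|) => x x_le i.
apply: (@le_trans _ _ (\sum_j `|A i j| * `|B|)).
  rewrite mxE ler_sum // => j _; apply: le_trans (ler_norm _) _.
  rewrite normrM ler_wpM2l //; exact: le_trans (x_le j) (ler_norm _).
rewrite [leRHS](bigD1 i) //= lerDl.
by apply: sumr_ge0 => k _; apply: sumr_ge0 => j _; rewrite mulr_ge0.
Qed.

(** * The Kullback-Leibler divergence *)

Lemma ln_le_subr1 (R : realType) (s : R) : 0 < s -> ln s <= s - 1.
Proof.
move=> s0; have := @le_ln1Dx R (s - 1); rewrite [1 + _]addrC subrK; apply; lra.
Qed.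

(** Quadratic growth with a denominator linear in [s], from [ln q <= q - 1] at
[q = sqrt s]: this gives [s - 1 - ln s >= (q - 1)^2], and
[(s - 1)^2 = (q - 1)^2 (q + 1)^2] with [(q + 1)^2 <= 2 (s + 1)]. *)
Lemma subr1_ln_ge (R : realType) (s : R) :
  0 < s -> (s - 1) ^+ 2 / (2 * (s + 1)) <= s - 1 - ln s.
Proof.
move=> s0; set q := Num.sqrt s.
have q0 : 0 < q by rewrite sqrtr_gt0.
have -> : s = q ^+ 2 by rewrite sqr_sqrtr // ltW.
have := ln_le_subr1 q0; rewrite lnXn // => lnq.
apply: (@le_trans _ _ ((q - 1) ^+ 2)); last by rewrite mulr2n; nra.
rewrite ler_pdivrMr; last by nra.
rewrite -subr_ge0.
have -> : (q - 1) ^+ 2 * (2 * (q ^+ 2 + 1)) - (q ^+ 2 - 1) ^+ 2 = ((q - 1) ^+ 2) ^+ 2.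
  by ring.
exact: sqr_ge0.
Qed.

(** From [ln u <= u - 1] at [u = 1 / (1 + s)]; the interval is chosen so that
[1 / (1 + s) <= 2]. *)
Lemma ln1D_ge (R : realType) (s : R) : - 2^-1 <= s -> s - 2 * s ^+ 2 <= ln (1 + s).
Proof.
move=> s_ge; have s1 : 0 < 1 + s by lra.
have := @ln_le_subr1 R (1 + s)^-1; rewrite invr_gt0 lnV ?posrE // => /(_ s1).
have -> : (1 + s)^-1 - 1 = - (s / (1 + s)) by field; rewrite gt_eqF.
rewrite lerN2; apply: le_trans.
rewrite ler_pdivlMr // -subr_ge0.
have -> : s - (s - 2 * s ^+ 2) * (1 + s) = s ^+ 2 * (1 + 2 * s) by ring.
by rewrite mulr_ge0 ?sqr_ge0 //; lra.
Qed.

Definition klr (R : realType) (y t : R) : R := y * ln (y / t) - y + t.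

Definition KLr (R : realType) (m : nat) (y z : 'cV[R]_m) : R :=
  \sum_i klr (y i 0) (z i 0).

Lemma KLE (R : realType) (m : nat) (y z : 'cV[R]_m) :
  KL y z = if [forall i, 0 < z i 0] then (KLr y z)%:E else +oo%E.
Proof.
case: ifPn => [/forallP z0|/forallPn[i zi]].
  by rewrite /KL /KLr -sumEFin; apply: eq_bigr => i _; rewrite /kl z0.
apply/eqP; rewrite esum_eqy.
  by apply/existsP; exists i; rewrite /kl (negPf zi).
by move=> j _; rewrite /kl; case: ifP.
Qed.

(** The Bregman divergence between [u] and [c] of the function [KL y]. *)
Definition bregman (R : realType) (m : nat) (y c u : 'cV[R]_m) : R :=
  \sum_i y i 0 * (u i 0 / c i 0 - 1 - ln (u i 0 / c i 0)).

(** The first term is the linearization of [KL y] at [c], whose gradient has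
coordinates [1 - y i / c i]. *)
Lemma KLr_bregman (R : realType) (m : nat) (y c u : 'cV[R]_m) :
  (forall i, 0 < y i 0) -> (forall i, 0 < c i 0) -> (forall i, 0 < u i 0) ->
  KLr y u - KLr y c =
    \sum_i (1 - y i 0 / c i 0) * (u i 0 - c i 0) + bregman y c u.
Proof.
move=> y0 c0 u0; rewrite /KLr /bregman -sumrB -big_split /=.
apply: eq_bigr => i _; rewrite /klr !ln_div ?posrE //.
by field; rewrite gt_eqF.
Qed.

(** [KL y] is strongly convex on bounded boxes only: [- ln] flattens at
infinity, hence the upper bound [B] on the coordinates. *)
Lemma bregman_quadratic_growth (R : realType) (m : nat) (y c : 'cV[R]_m) (B : R) :
  (forall i, 0 < y i 0) -> (forall i, 0 < c i 0) ->
  exists2 K : R, 0 <= K & forall u : 'cV[R]_m,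
    (forall i, 0 < u i 0 <= B) ->
    forall i, (u i 0 - c i 0) ^+ 2 <= K * bregman y c u.
Proof.
move=> y0 c0; pose K i := c i 0 * (2 * (`|B| + c i 0)) / y i 0.
have K0 i : 0 <= K i.
  by rewrite !mulr_ge0 ?addr_ge0 // ?invr_ge0 ltW.
exists (\sum_i K i); first exact: sumr_ge0.
move=> u u_ok i.
have term_ge0 j : 0 <= y j 0 * (u j 0 / c j 0 - 1 - ln (u j 0 / c j 0)).
  have /andP[uj _] := u_ok j.
  by rewrite mulr_ge0 ?(ltW (y0 _)) // subr_ge0 ln_le_subr1 // divr_gt0.
apply: (@le_trans _ _ (K i * (y i 0 * (u i 0 / c i 0 - 1 - ln (u i 0 / c i 0))))).
  have /andP[ui uB] := u_ok i; have ci := c0 i; have yi := y0 i.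
  have /subr1_ln_ge : 0 < u i 0 / c i 0 by rewrite divr_gt0.
  set l := ln _ => growth.
  have -> : K i * (y i 0 * (u i 0 / c i 0 - 1 - l)) =
      c i 0 * (2 * (`|B| + c i 0)) * (u i 0 / c i 0 - 1 - l).
    by rewrite /K; field; rewrite !gt_eqF.
  apply: le_trans (ler_wpM2l _ growth); last first.
    by rewrite !mulr_ge0 ?addr_ge0 // ltW.
  have -> : c i 0 * (2 * (`|B| + c i 0)) *
      ((u i 0 / c i 0 - 1) ^+ 2 / (2 * (u i 0 / c i 0 + 1))) =
      (`|B| + c i 0) / (u i 0 + c i 0) * (u i 0 - c i 0) ^+ 2.
    by field; rewrite !gt_eqF // addr_gt0.
  rewrite ler_peMl ?sqr_ge0 // ler_pdivlMr ?addr_gt0 // mul1r lerD2r.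
  exact: le_trans uB (ler_norm _).
apply: ler_pM => //; first by rewrite (bigD1 i) //= lerDl sumr_ge0.
by rewrite /bregman (bigD1 i) //= lerDl sumr_ge0.
Qed.

(** First-order optimality condition at [c] along the direction [d], [G] being
the slope of the convex part: the error of the linearization is at most
[K * t ^+ 2], so a negative slope would make the objective decrease for small
[t]. *)
Lemma KLr_first_order (R : realType) (m : nat) (y c d : 'cV[R]_m) (G : R) :
  (forall i, 0 < y i 0) -> (forall i, 0 < c i 0) ->
  (forall t, 0 < t <= 1 -> (forall i, 0 < (c + t *: d) i 0) ->
    KLr y c <= t * G + KLr y (c + t *: d)) ->
  0 <= G + \sum_i (1 - y i 0 / c i 0) * d i 0.
Proof.
move=> y0 c0 descent; rewrite leNgt; apply/negP.
set S := \sum_i _ => GS.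
pose K := \sum_i 2 * y i 0 * (d i 0 / c i 0) ^+ 2.
have K0 : 0 <= K.
  by apply: sumr_ge0 => i _; rewrite mulr_ge0 ?sqr_ge0 // mulr_ge0 // ltW.
pose T := \sum_i `|d i 0 / c i 0|.
have T0 : 0 <= T by exact: sumr_ge0.
pose dl := - (G + S); have dl0 : 0 < dl by rewrite oppr_gt0.
(* The step t = 1 / D is small enough to have t <= 1, t * T <= 1/2 (so that the
   perturbed point stays positive and ln1D_ge applies) and t * K < dl. *)
pose D := 2 + 2 * T + K / dl.
have Kdl0 : 0 <= K / dl by rewrite divr_ge0 // ltW.
have D2 : 2 <= D by rewrite /D; lra.
pose t := D^-1.
have t0 : 0 < t by rewrite invr_gt0; lra.
have t1 : t <= 1 by rewrite invf_le1; lra.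
have tT : t * T <= 2^-1.
  by rewrite mulrC ler_pdivrMr; last lra; rewrite /D; lra.
have tK : t * K < dl.
  rewrite mulrC ltr_pdivrMr; last by lra.
  rewrite /D mulrDr mulrCA divff ?gt_eqF // mulr1 ltrDr.
  by rewrite mulr_gt0 //; lra.
have small i : `|t * (d i 0 / c i 0)| <= 2^-1.
  apply: le_trans tT; rewrite normrM gtr0_norm // ler_wpM2l ?(ltW t0) //.
  by rewrite /T (bigD1 i) //= lerDl sumr_ge0.
have sE i : (c + t *: d) i 0 / c i 0 = 1 + t * (d i 0 / c i 0).
  by rewrite !mxE mulrDl divff ?gt_eqF // mulrA.
have u0 i : 0 < (c + t *: d) i 0.
  have -> : (c + t *: d) i 0 = c i 0 * (1 + t * (d i 0 / c i 0)).
    by rewrite -sE mulrC divfK ?gt_eqF.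
  by rewrite mulr_gt0 //; have := small i; rewrite ler_norml; lra.
have := descent t; rewrite t0 t1 => /(_ isT u0).
have := KLr_bregman y0 c0 u0.
have -> : \sum_i (1 - y i 0 / c i 0) * ((c + t *: d) i 0 - c i 0) = t * S.
  by rewrite mulr_sumr; apply: eq_bigr => i _; rewrite !mxE; ring.
have : bregman y c (c + t *: d) <= t ^+ 2 * K.
  rewrite mulr_sumr ler_sum // => i _; rewrite sE.
  have -> : t ^+ 2 * (2 * y i 0 * (d i 0 / c i 0) ^+ 2) =
    y i 0 * (2 * (t * (d i 0 / c i 0)) ^+ 2) by ring.
  rewrite ler_wpM2l ?(ltW (y0 i)) //.
  have /ln1D_ge : - 2^-1 <= t * (d i 0 / c i 0).
    by have := small i; rewrite ler_norml => /andP[].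
  by lra.
have : t * (t * K) < t * dl by rewrite ltr_pM2l.
by rewrite /dl; lra.
Qed.

(** * Conditioning *)

Theorem proposition3p21 (R : realType) (N M : nat) (g : 'cV[R]_N -> \bar R)
    (hg : Gamma0 g) (hpoly : polyhedral g)
    (A : 'M[R]_(M, N)) (y : 'cV[R]_M) (hy : forall i, 0 < y i 0) :
  let f := fun x : 'cV[R]_N => (g x + KL y (A *m x))%E in
  argmin f !=set0 -> two_conditioned_on_bounded_sets f.
Proof.
move=> f [xs xs_min] Omega bndO.
have [[_ gNy] gconv _] := hg.
have f_fin x : (f x < +oo)%E -> exists2 a, g x = a%:E &
    (forall i, 0 < (A *m x) i 0) /\ f x = (a + KLr y (A *m x))%:E.
  rewrite /f KLE; case: ifPn => [/forallP Ax|_]; have := gNy x;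
    case: (g x) => [a||] //= _ _.
  by exists a.
have f_le x a : (g x <= a%:E)%E -> (forall i, 0 < (A *m x) i 0) ->
    (f x <= (a + KLr y (A *m x))%:E)%E.
  move=> gx Ax; rewrite /f KLE ifT; last exact/forallP.
  by rewrite EFinD leeD2r.
have [xs_fin|] := ltP (f xs) +oo%E; last first.
  rewrite leye_eq => /eqP fxs; exists 1 => // x [_] /(le_lt_trans (xs_min x)).
  by rewrite fxs.
have [gs gxs [c0 fxs]] := f_fin xs xs_fin.
set c := A *m xs in c0 fxs.
pose w i := 1 - y i 0 / c i 0.
pose v : 'rV[R]_N := \row_i w i *m A.
have vE x : (v *m x) 0 0 = \sum_i w i * (A *m x) i 0.
  by rewrite -mulmxA mxE; apply: eq_bigr => i _; rewrite mxE.
pose m := gs + (v *m xs) 0 0.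
(* The polyhedral function h x = g x + v x - m, where v is the gradient of
   KL y (A x) at xs, is nonnegative and vanishes at xs. *)
have first_order x a : g x = a%:E -> m <= a + (v *m x) 0 0.
  move=> gx.
  have : 0 <= (a - gs) + \sum_i w i * (A *m (x - xs)) i 0.
    apply: KLr_first_order => // t /andP[t0 t1].
    pose xt := t *: x + (1 - t) *: xs.
    have Axt : A *m xt = c + t *: (A *m (x - xs)).
      have -> : xt = xs + t *: (x - xs).
        by apply/matrixP => i j; rewrite /xt !mxE; ring.
      by rewrite mulmxDr scalemxAr.
    rewrite -Axt => Axt0.
    have gxt : (g xt <= (t * a + (1 - t) * gs)%:E)%E.
      by have := @gconv x xs t; rewrite (ltW t0) t1 gx gxs; exact.
    have := le_trans (xs_min xt) (f_le _ _ gxt Axt0).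
    by rewrite fxs lee_fin; lra.
  rewrite -vE.
  have -> : (v *m (x - xs)) 0 0 = (v *m x) 0 0 - (v *m xs) 0 0.
    by rewrite mulmxBr mxE; congr (_ + _); rewrite mxE.
  by rewrite /m; lra.
have gapE x a : (forall i, 0 < (A *m x) i 0) ->
    (a + KLr y (A *m x)) - (gs + KLr y c) =
    (a + (v *m x) 0 0 - m) + bregman y c (A *m x).
  move=> Ax0; have := KLr_bregman hy c0 Ax0.
  have -> : \sum_i (1 - y i 0 / c i 0) * ((A *m x) i 0 - c i 0) =
      (v *m x) 0 0 - (v *m xs) 0 0.
    by rewrite !vE -sumrB; apply: eq_bigr => i _; rewrite mulrBr.
  by rewrite /m; lra.
have gs_le : (g xs <= gs%:E)%E by rewrite gxs.
have [L L0 HL] := polyhedral_error_bound hpoly gs_le (lexx m) (erefl c).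
(* Exact solutions of the lifted system are minimizers. *)
have sol_min q t : (g q <= t%:E)%E -> t + (v *m q) 0 0 <= m -> A *m q = c ->
    argmin f q.
  move=> gq tq Aq z; apply: le_trans (xs_min z); rewrite fxs -Aq.
  apply: le_trans (f_le _ _ gq _) _; first by rewrite Aq.
  by move: tq; rewrite !vE Aq lee_fin lerD2r /m vE /c; lra.
have [B B0 OB] := bounded_coord bndO.
have [B' HB'] := mulmx_coord_le A B.
have [K K0 HK] := bregman_quadratic_growth B' hy c0.
pose Bs := \sum_j (B + `|xs j 0|).
have BsP x : Omega x -> forall j, `|x j 0 - xs j 0| <= Bs.
  move=> Ox j; apply: le_trans (ler_normB _ _) _.
  rewrite /Bs (bigD1 j) //= -addrA lerD ?OB // lerDl.
  by apply: sumr_ge0 => i _; rewrite addr_ge0.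
(* The three summands make Q positive, cover gaps f x - inf f >= 1 (by the
   bounded distance to xs), and cover gaps < 1 (by the error bound). *)
pose Q := 1 + N%:R * Bs ^+ 2 + N%:R * L ^+ 2 * (1 + K).
have NB0 : 0 <= N%:R * Bs ^+ 2 by rewrite mulr_ge0 ?sqr_ge0.
have NL0 : 0 <= N%:R * L ^+ 2 by rewrite mulr_ge0 ?sqr_ge0.
have NLK0 : 0 <= N%:R * L ^+ 2 * (1 + K) by rewrite mulr_ge0 ?addr_ge0.
have Q0 : 0 < Q by rewrite /Q; lra.
exists (2 / Q); first by rewrite divr_gt0.
move=> x [Ox] /f_fin[a gx [Ax0 fx]].
have -> : ereal_inf (range f) = f xs.
  apply/eqP; rewrite eq_le; apply/andP; split.
    by apply: ge_ereal_inf; exists (f xs) => //; exists xs.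
  by apply: le_ereal_inf_tmp => _ [z _ <-]; exact: xs_min.
rewrite fx fxs -EFinB lee_fin gapE //.
set h := a + _ - m; set D := bregman _ _ _.
have h0 : 0 <= h by rewrite subr_ge0; exact: first_order.
have D0 : 0 <= D.
  apply: sumr_ge0 => i _; rewrite mulr_ge0 ?(ltW (hy _)) //.
  by rewrite subr_ge0 ln_le_subr1 // divr_gt0.
have -> : 2 / Q / 2 = Q^-1 by field; rewrite gt_eqF.
rewrite mulrC ler_pdivrMr //.
(* The error bound is linear in h, so the square of the distance is controlled
   by h ^+ 2, which is at most h only when h <= 1. *)
have [gap1|gap1] := leP 1 (h + D).
  apply: le_trans (edistance_sqr_le xs_min (BsP x Ox)) _.
  by rewrite /Q; nra.
(* All violations of the lifted system at (x, g x) are at most e. *)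
pose e := Num.sqrt ((1 + K) * (h + D)).
have gap0 : 0 <= h + D by rewrite addr_ge0.
have e2 : e ^+ 2 = (1 + K) * (h + D).
  by apply: sqr_sqrtr; apply: mulr_ge0 => //; exact: addr_ge0.
have le_e s : 0 <= s -> s ^+ 2 <= (1 + K) * (h + D) -> s <= e.
  by move=> s0 sK; rewrite -(ger0_norm s0) -sqrtr_sqr ler_wsqrtr.
have [||i|q [t [gq tq Aq xq]]] := HL e a x (sqrtr_ge0 _).
- by rewrite gx.
- have : h <= e by apply: le_e => //; nra.
  by rewrite /h; lra.
- apply: le_e => //; rewrite real_normK ?num_real //.
  have := HK (A *m x) _ i; rewrite -/D => HKx.
  apply: le_trans (HKx _) _; last by nra.
  by move=> k; rewrite Ax0 HB' //; exact: OB.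
apply: le_trans (edistance_sqr_le (sol_min _ _ gq tq Aq) xq) _.
rewrite exprMn mulrA e2 mulrA [leRHS]mulrC ler_wpM2r //.
by rewrite /Q; lra.
Qed.
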